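(* Let $\lambda_1\ge\lambda_2\ge\lambda_3\ge\lambda_4\ge0$ with $\sum_i\lambda_i=1$, and let $$\rho_{\vec\lambda}=\lambda_1\Phi_1+\lambda_2|01\rangle\langle01|+\lambda_3\Phi_2+\lambda_4|10\rangle\langle10|,\qquad \sigma_{\vec\lambda}=\sum_{j=1}^4\lambda_j\Phi_j.$$ Suppose $\vec\lambda=(\lambda_1,\lambda_2,\lambda_3,\lambda_4)$ lies in one of the regions $A=\{2\lambda_2+\lambda_3-\lambda_1<0,\ 2\lambda_3+\lambda_4-\lambda_2<0\}$, $B=\{2\lambda_2+\lambda_3-\lambda_1<0,\ 2\lambda_3+\lambda_4-\lambda_2\ge0,\ \lambda_3\le2\lambda_4,\ \lambda_2>\lambda_3+\lambda_4\}$, $C=\{2\lambda_2+\lambda_3-\lambda_1<0,\ 2\lambda_3+\lambda_4-\lambda_2\ge0,\ \lambda_3>2\lambda_4,\ \lambda_2>\tfrac32\lambda_3\}$. Then there exists no non-entangling map $\Lambda:\mathcal{D}\to\mathcal{D}$ such that $\Lambda(\rho_{\vec\lambda})=\sigma_{\vec\lambda}$.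
   Context: $\mathcal{D}$ is the set of two-qubit density matrices on $\mathbb{C}^2\otimes\mathbb{C}^2$ (Hermitian, positive semidefinite, trace one $4\times4$ matrices), written in the computational basis $\{|ij\rangle\}_{i,j\in\{0,1\}}$. The Bell vectors are $|\Phi_1\rangle=\frac{1}{\sqrt2}(|00\rangle+|11\rangle)$, $|\Phi_2\rangle=\frac{1}{\sqrt2}(|00\rangle-|11\rangle)$, $|\Phi_3\rangle=\frac{1}{\sqrt2}(|10\rangle+|01\rangle)$, $|\Phi_4\rangle=\frac{1}{\sqrt2}(|10\rangle-|01\rangle)$, and $\Phi_i=|\Phi_i\rangle\langle\Phi_i|$. A state is separable if it is a convex combination of product states $|\phi\rangle\langle\phi|\otimes|\chi\rangle\langle\chi|$. A map $\Lambda:\mathcal{D}\to\mathcal{D}$ is non-entangling (NE) if it is completely positive and trace preserving and maps every separable state to a separable state. *)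

(* Defs.v *)
From HB Require Import structures.
From mathcomp Require Import all_boot all_order all_algebra.
From mathcomp Require Import reals complex.
Set Implicit Arguments. Unset Strict Implicit. Unset Printing Implicit Defensive.
Import Order.TTheory GRing.Theory Num.Theory.
Local Open Scope ring_scope.

Section QDefs.
Variable R : realType.
Local Notation C := (R[i]).

Definition adjmx m n (A : 'M[C]_(m, n)) : 'M[C]_(n, m) := (map_mx Num.conj A)^T.

Definition hermitian n (A : 'M[C]_n) : Prop := adjmx A = A.

Definition psd n (A : 'M[C]_n) : Prop :=
  hermitian A /\ forall v : 'cV[C]_n, 0 <= (adjmx v *m A *m v) 0 0.

Definition is_state (A : 'M[C]_4) : Prop := psd A /\ \tr A = 1.

(* computational basis |ij> of C^2 (x) C^2 is indexed by 2*i+j *)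
Definition hi (k : 'I_4) : 'I_2 := inord (k %/ 2).
Definition lo (k : 'I_4) : 'I_2 := inord (k %% 2).

Definition kron2 (A B : 'M[C]_2) : 'M[C]_4 :=
  \matrix_(k, l) (A (hi k) (hi l) * B (lo k) (lo l)).

Definition unit_vec n (v : 'cV[C]_n) : Prop := (adjmx v *m v) 0 0 = 1.

Definition product_state (P : 'M[C]_4) : Prop :=
  exists (phi chi : 'cV[C]_2), unit_vec phi /\ unit_vec chi /\
    P = kron2 (phi *m adjmx phi) (chi *m adjmx chi).

Definition separable (rho : 'M[C]_4) : Prop :=
  exists (m : nat) (p : 'I_m -> R) (P : 'I_m -> 'M[C]_4),
    (forall i, 0 <= p i) /\ \sum_(i < m) p i = 1 /\
    (forall i, product_state (P i)) /\
    rho = \sum_(i < m) ((p i)%:C)%C *: P i.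

(* complete positivity: id_n (x) Lambda is positive for every n, where an
   operator on C^n (x) C^4 is written as an n x n block matrix of 4x4 blocks *)
Definition completely_positive (L : 'M[C]_4 -> 'M[C]_4) : Prop :=
  forall (n : nat) (B : 'I_n -> 'I_n -> 'M[C]_4),
    psd (\mxblock_(i < n, j < n) B i j) ->
    psd (\mxblock_(i < n, j < n) L (B i j)).

Definition trace_preserving (L : 'M[C]_4 -> 'M[C]_4) : Prop :=
  forall X, \tr (L X) = \tr X.

Definition non_entangling (L : {linear 'M[C]_4 -> 'M[C]_4}) : Prop :=
  completely_positive L /\ trace_preserving L /\
  forall rho, is_state rho -> separable rho -> separable (L rho).

Definition ket (i j : nat) : 'cV[C]_4 := delta_mx (inord (2 * i + j)) 0.

Definition invsqrt2 : C := (((Num.sqrt (2 : R))^-1)%:C)%C.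

Definition Bell1 : 'cV[C]_4 := invsqrt2 *: (ket 0 0 + ket 1 1).
Definition Bell2 : 'cV[C]_4 := invsqrt2 *: (ket 0 0 - ket 1 1).
Definition Bell3 : 'cV[C]_4 := invsqrt2 *: (ket 1 0 + ket 0 1).
Definition Bell4 : 'cV[C]_4 := invsqrt2 *: (ket 1 0 - ket 0 1).

Definition proj n (v : 'cV[C]_n) : 'M[C]_n := v *m adjmx v.

Definition Phi1 := proj Bell1.
Definition Phi2 := proj Bell2.
Definition Phi3 := proj Bell3.
Definition Phi4 := proj Bell4.

Definition rho_lam (l1 l2 l3 l4 : R) : 'M[C]_4 :=
  (l1%:C)%C *: Phi1 + (l2%:C)%C *: proj (ket 0 1) + (l3%:C)%C *: Phi2 + (l4%:C)%C *: proj (ket 1 0).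

Definition sigma_lam (l1 l2 l3 l4 : R) : 'M[C]_4 :=
  (l1%:C)%C *: Phi1 + (l2%:C)%C *: Phi2 + (l3%:C)%C *: Phi3 + (l4%:C)%C *: Phi4.

Definition regionA (l1 l2 l3 l4 : R) : Prop :=
  2 * l2 + l3 - l1 < 0 /\ 2 * l3 + l4 - l2 < 0.
Definition regionB (l1 l2 l3 l4 : R) : Prop :=
  2 * l2 + l3 - l1 < 0 /\ 2 * l3 + l4 - l2 >= 0 /\ l3 <= 2 * l4 /\ l2 > l3 + l4.
Definition regionC (l1 l2 l3 l4 : R) : Prop :=
  2 * l2 + l3 - l1 < 0 /\ 2 * l3 + l4 - l2 >= 0 /\ l3 > 2 * l4 /\ l2 > 3 / 2 * l3.

End QDefs.

(* Main.v *)
(* Let Pr(s | X) = <Bell_s| L X |Bell_s> with Bell_s = (|00> + s|11>)/sqrt 2 and s = +-1.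
   It is at most 1/2 on product states X; since (2 Phi_t + |01><01| + |10><10|)/4
   is a mixture of product states, Pr(s | Phi_t) + (Pr(s | 01) + Pr(s | 10))/2 <= 1.
   As Pr(1 | rho) = l1 and l1 > 2 l2 + l3, this forces Pr(1 | Phi1) = 1, hence
   Pr(-1 | Phi1) = 0.  The bounds on the other Pr(-1 | X) then keep Pr(-1 | rho)
   strictly below l2: regions A, B and C are those where this linear program is
   infeasible. *)
Require Import Defs.
From HB Require Import structures.
From mathcomp Require Import all_boot all_order all_algebra.
From mathcomp Require Import reals complex.
From mathcomp Require Import ring lra.
Import Order.TTheory GRing.Theory Num.Theory.
Local Open Scope ring_scope.

Section Expectations.
Set Implicit Arguments. Unset Strict Implicit.
Variable R : realType.
Local Notation C := (R[i]).
Implicit Types (A B P : 'M[C]_4) (s w : C).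

(** * Positive semidefinite matrices and positivity of completely positive maps *)

Lemma adjmxE m n (A : 'M[C]_(m, n)) i j : adjmx A i j = (A j i)^*.
Proof. by rewrite !mxE. Qed.

Lemma projE n (v : 'cV[C]_n) i j : proj v i j = v i 0 * (v j 0)^*.
Proof. by rewrite !mxE big_ord1 !mxE. Qed.

Lemma psd_proj n (v : 'cV[C]_n) : psd (proj v).
Proof.
split; first by apply/matrixP => i j; rewrite adjmxE !projE rmorphM /= conjCK mulrC.
move=> u; rewrite /proj !mulmxA -mulmxA mxE big_ord1.
suff -> : (adjmx v *m u) 0 0 = ((adjmx u *m v) 0 0)^* by exact: mul_conjC_ge0.
rewrite !mxE rmorph_sum; apply: eq_bigr => k _.
by rewrite !adjmxE rmorphM /= conjCK mulrC.
Qed.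

(** Adjoint and quadratic form of a matrix with a single block are those of the block. This gives
    access to the case [n = 1] of complete positivity, which is plain positivity of the map. *)
Lemma psd_mxblock1 n (A : 'M[C]_n) :
  psd A <-> psd (\mxblock_(i < 1, j < 1) A).
Proof.
have adjblock : adjmx (\mxblock_(i < 1, j < 1) A) = \mxblock_(i < 1, j < 1) adjmx A.
  by apply/matrixP => i j; rewrite !mxE.
have quad (v : 'I_1 -> 'cV[C]_n) :
    adjmx (\mxcol_(i < 1) v i) *m (\mxblock_(i < 1, j < 1) A) *m (\mxcol_(i < 1) v i)
    = adjmx (v 0) *m A *m v 0.
  have -> : adjmx (\mxcol_(i < 1) v i) = \mxrow_(i < 1) adjmx (v i).
    by apply/matrixP => i j; rewrite !mxE.
  by rewrite mul_mxrow_mxblock mul_mxrow_mxcol !big_ord1.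
split=> -[hA pA]; split.
- by rewrite /Defs.hermitian adjblock hA.
- move=> v; rewrite -(submxcolK v) (quad (fun i => submxcol v i)); exact: pA.
- have /mxblockP/(_ 0 0) := hA.
  by rewrite adjblock !mxblockK.
- by move=> v; have := pA (\mxcol_(i < 1) v); rewrite (quad (fun=> v)).
Qed.

Lemma completely_positive_psd (L : 'M[C]_4 -> 'M[C]_4) A :
  completely_positive L -> psd A -> psd (L A).
Proof.
by move=> cpL /psd_mxblock1 pA; apply/psd_mxblock1; apply: (cpL 1 (fun _ _ => A)).
Qed.

Lemma adjmx_delta m n (i : 'I_m) (j : 'I_n) :
  adjmx (delta_mx i j : 'M[C]_(m, n)) = delta_mx j i.
Proof. by apply/matrixP => k l; rewrite !mxE andbC conjC_nat. Qed.

Lemma psd_diag_ge0 n (A : 'M[C]_n) k : psd A -> 0 <= A k k.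
Proof.
case=> _ /(_ (delta_mx k 0)); congr (0 <= _).
by rewrite adjmx_delta -rowE -colE !mxE.
Qed.

(** * The Bell vectors with sign [s] and the expectation in them *)

Definition bell s : 'cV[C]_4 := invsqrt2 R *: (ket R 0 0 + s *: ket R 1 1).

Lemma Bell1E : Bell1 R = bell 1.
Proof. by rewrite /bell scale1r. Qed.

Lemma Bell2E : Bell2 R = bell (-1).
Proof. by rewrite /bell scaleN1r. Qed.

Lemma invsqrt2_sqr : invsqrt2 R * invsqrt2 R = 2^-1.
Proof.
rewrite /invsqrt2 -rmorphM /= -invfM -expr2 sqr_sqrtr ?ler0n //.
by rewrite fmorphV rmorph_nat.
Qed.

Lemma conj_invsqrt2 : (invsqrt2 R)^* = invsqrt2 R.
Proof. by rewrite /invsqrt2; exact: conjc_real. Qed.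

(** The expectation of [A] in [bell s], expanded into entries on |00> and |11>, so that linearity in
    [A] is visible. For a real sign [s], [bell_expE] identifies it with the quadratic form. *)
Definition bell_exp s A : C :=
  (A (inord 0) (inord 0) + A (inord 3) (inord 3)
   + s * (A (inord 0) (inord 3) + A (inord 3) (inord 0))) / 2.

Lemma bell_expE s A : s * s = 1 -> s^* = s ->
  bell_exp s A = (adjmx (bell s) *m A *m bell s) 0 0.
Proof.
move=> s2 sR.
have -> : adjmx (bell s) =
    invsqrt2 R *: (delta_mx 0 (inord 0) + s *: delta_mx 0 (inord 3)).
  apply/matrixP => i j; rewrite (ord1 i) /bell /ket !mxE /= !eqxx !andbT.
  by rewrite rmorphM rmorphD rmorphM /= conj_invsqrt2 sR !conjC_nat.
rewrite /bell /ket -!(scalemxAl, scalemxAr) !mulmxDl -!scalemxAl.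
rewrite !mulmxDr -!scalemxAr -!rowE -!colE !mxE /bell_exp -invsqrt2_sqr.
ring: s2.
Qed.

Lemma bell_exp_is_linear s : linear_for *%R (bell_exp s).
Proof. by move=> c A B; rewrite /bell_exp !mxE; ring. Qed.

HB.instance Definition _ s :=
  GRing.isLinear.Build C 'M[C]_4 C *%R (bell_exp s) (bell_exp_is_linear s).

Lemma bell_exp_ge0 s A : s * s = 1 -> s^* = s -> psd A -> 0 <= bell_exp s A.
Proof. by move=> s2 sR [_ pA]; rewrite bell_expE. Qed.

Lemma ord4_ind (Q : 'I_4 -> Prop) :
  Q (inord 0) -> Q (inord 1) -> Q (inord 2) -> Q (inord 3) -> forall k, Q k.
Proof.
move=> Q0 Q1 Q2 Q3 k; rewrite -(inord_val k).
by case: k => -[|[|[|[|]]]] //=.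
Qed.

Lemma big_inord4 (V : nmodType) (f : 'I_4 -> V) :
  \sum_k f k = f (inord 0) + f (inord 1) + f (inord 2) + f (inord 3).
Proof.
rewrite !big_ord_recl big_ord0 addr0 !addrA.
by do !congr (_ + _); congr f; apply/val_inj; rewrite /= inordK.
Qed.

Lemma big_inord2 (V : nmodType) (f : 'I_2 -> V) :
  \sum_k f k = f (inord 0) + f (inord 1).
Proof.
rewrite !big_ord_recl big_ord0 addr0.
by do !congr (_ + _); congr f; apply/val_inj; rewrite /= inordK.
Qed.

(** * Product vectors and the bound 1/2 on separable states *)

Lemma unit_vec2 (phi : 'cV[C]_2) : unit_vec phi <->
  phi (inord 0) 0 * (phi (inord 0) 0)^* + phi (inord 1) 0 * (phi (inord 1) 0)^* = 1.
Proof.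
rewrite /unit_vec mxE big_inord2 !adjmxE.
by rewrite ![(phi _ _)^* * _]mulrC.
Qed.

Definition kronv (phi chi : 'cV[C]_2) : 'cV[C]_4 :=
  \col_k (phi (hi k) 0 * chi (lo k) 0).

Lemma kron2_proj phi chi : kron2 (proj phi) (proj chi) = proj (kronv phi chi).
Proof.
apply/matrixP => k l; rewrite projE !mxE !big_ord1 !mxE rmorphM /=; ring.
Qed.

Lemma kronvE phi chi :
  [/\ kronv phi chi (inord 0) 0 = phi (inord 0) 0 * chi (inord 0) 0,
      kronv phi chi (inord 1) 0 = phi (inord 0) 0 * chi (inord 1) 0,
      kronv phi chi (inord 2) 0 = phi (inord 1) 0 * chi (inord 0) 0
    & kronv phi chi (inord 3) 0 = phi (inord 1) 0 * chi (inord 1) 0].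
Proof. by split; rewrite mxE /hi /lo !inordK. Qed.

Lemma product_state_state P : product_state P -> is_state P.
Proof.
case=> phi [chi [/unit_vec2 uphi [/unit_vec2 uchi ->]]].
rewrite [kron2 _ _]kron2_proj; split; first exact: psd_proj.
have [e0 e1 e2 e3] := kronvE phi chi.
(* The target 1 is written as the product of the two squared norms, which makes the trace condition
   a polynomial identity. *)
rewrite /mxtrace big_inord4 !projE e0 e1 e2 e3 -(mulr1 1) -{1}uphi -uchi.
by rewrite !rmorphM /=; ring.
Qed.

Lemma product_state_separable P : product_state P -> separable P.
Proof.
move=> PP; exists 1%N, (fun=> 1), (fun=> P); split=> [_|]; first exact: ler01.
by rewrite !big_ord1 scale1r.
Qed.

(* Lagrange: [|<phi|><chi|>|^2 = 1] splits as
   [|phi0 chi0 + s phi1 chi1|^2 + |phi0 chi1^* - s phi1 chi0^*|^2]. *)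
Lemma bell_exp_product s P : s * s = 1 -> s^* = s ->
  product_state P -> bell_exp s P <= 2^-1.
Proof.
move=> s2 sR [phi [chi [/unit_vec2 uphi [/unit_vec2 uchi ->]]]].
rewrite [kron2 _ _]kron2_proj /bell_exp !projE.
have [-> _ _ ->] := kronvE phi chi.
move: uphi uchi; set p := phi _ _; set q := phi _ _.
set x := chi _ _; set y := chi _ _ => uphi uchi.
pose z := p * y^* - s * q * x^*.
rewrite -subr_ge0.
suff -> : 2^-1 - (p * x * (p * x)^* + q * y * (q * y)^*
    + s * (p * x * (q * y)^* + q * y * (p * x)^*)) / 2 = z * z^* / 2.
  by rewrite divr_ge0 ?mul_conjC_ge0 ?ler0n.
have {1}-> : 2^-1 = (p * p^* + q * q^*) * (x * x^* + y * y^*) / 2 :> C.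
  by rewrite uphi uchi; ring.
by rewrite /z !(rmorphB, rmorphM) /= !conjCK sR; ring: s2.
Qed.

Lemma bell_exp_separable s A : s * s = 1 -> s^* = s ->
  separable A -> bell_exp s A <= 2^-1.
Proof.
move=> s2 sR [m [p [P [p0 [p1 [PP ->]]]]]]; rewrite linear_sum /=.
have -> : 2^-1 = \sum_i ((p i)%:C)%C * 2^-1 :> C.
  by rewrite -mulr_suml -rmorph_sum p1 mul1r.
apply: ler_sum => i _; rewrite linearZ /= ler_wpM2l ?ler0c //.
exact: bell_exp_product.
Qed.

Lemma product_state_ket i j : (i < 2)%N -> (j < 2)%N ->
  product_state (proj (ket R i j)).
Proof.
move=> i2 j2; exists (delta_mx (inord i) 0), (delta_mx (inord j) 0).
do 2?split; try by rewrite /unit_vec adjmx_delta mul_delta_mx mxE !eqxx.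
rewrite [kron2 _ _]kron2_proj; congr proj; apply/matrixP => k l.
rewrite (ord1 l) !mxE /hi /lo !eqxx !andbT -!val_eqE /=.
case: i i2 => [|[|//]] _; case: j j2 => [|[|//]] _; elim/ord4_ind: k;
  by rewrite !inordK //= ?mulr0 ?mul0r ?mulr1.
Qed.

(** * Mixtures of product states that contain Bell projectors *)

Definition phase_vec w : 'cV[C]_2 :=
  invsqrt2 R *: (delta_mx (inord 0) 0 + w *: delta_mx (inord 1) 0).
(** The two phases multiply to [s] whenever [w] has modulus 1. The component on |00> and |11> is
    then proportional to [bell s] for every such [w], and only the amplitudes of |01> and |10>
    rotate. *)
Definition phase_state s w : 'M[C]_4 :=
  proj (kronv (phase_vec w) (phase_vec (s * w^*))).

Lemma phase_vecE w :
  phase_vec w (inord 0) 0 = invsqrt2 R /\ phase_vec w (inord 1) 0 = invsqrt2 R * w.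
Proof.
by rewrite /phase_vec !mxE -!val_eqE /= !inordK //= mulr1 mulr0 addr0 add0r mulr1.
Qed.

Lemma phase_vec_unit w : w * w^* = 1 -> unit_vec (phase_vec w).
Proof.
move=> w1; apply/unit_vec2; have [-> ->] := phase_vecE w.
by rewrite rmorphM /= conj_invsqrt2 mulrACA w1 invsqrt2_sqr mulr1 -[2^-1]div1r -splitr.
Qed.

Lemma phase_state_product s w : s * s = 1 -> s^* = s -> w * w^* = 1 ->
  product_state (phase_state s w).
Proof.
move=> s2 sR w1; exists (phase_vec w), (phase_vec (s * w^*)).
split; first exact: phase_vec_unit.
split; last by rewrite [RHS]kron2_proj.
apply: phase_vec_unit; rewrite rmorphM /= conjCK sR; ring: s2 w1.
Qed.

Definition vec4 (a b c d : C) : 'cV[C]_4 := \col_k nth 0 [:: a; b; c; d] k.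

Lemma vec4P (v : 'cV[C]_4) a b c d :
  v (inord 0) 0 = a -> v (inord 1) 0 = b -> v (inord 2) 0 = c ->
  v (inord 3) 0 = d -> v = vec4 a b c d.
Proof.
move=> va vb vc vd; apply/colP => k; rewrite mxE.
by elim/ord4_ind: k; rewrite inordK.
Qed.

Lemma bell_vec4 s : bell s = vec4 (invsqrt2 R) 0 0 (invsqrt2 R * s).
Proof.
by apply: vec4P; rewrite /bell /ket !mxE !eqxx !andbT -!val_eqE /= !inordK //=;
  rewrite ?(mulr1, mulr0, addr0, add0r).
Qed.

Lemma kronv_phase_vec w w' :
  kronv (phase_vec w) (phase_vec w') = vec4 2^-1 (2^-1 * w') (2^-1 * w) (2^-1 * (w * w')).
Proof.
have [k0 k1 k2 k3] := kronvE (phase_vec w) (phase_vec w').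
have [p0 p1] := phase_vecE w; have [q0 q1] := phase_vecE w'.
rewrite p0 q0 in k0; rewrite p0 q1 in k1; rewrite p1 q0 in k2; rewrite p1 q1 in k3.
by apply: vec4P; rewrite ?k0 ?k1 ?k2 ?k3 -invsqrt2_sqr; ring.
Qed.

Lemma phase_stateE s w : phase_state s w =
  proj (vec4 2^-1 (2^-1 * (s * w^*)) (2^-1 * w) (2^-1 * (w * (s * w^*)))).
Proof. by congr proj; exact: kronv_phase_vec. Qed.

Lemma ket01_vec4 : ket R 0 1 = vec4 0 1 0 0.
Proof. by apply: vec4P; rewrite mxE eqxx andbT -val_eqE /= !inordK. Qed.

Lemma ket10_vec4 : ket R 1 0 = vec4 0 0 1 0.
Proof. by apply: vec4P; rewrite mxE eqxx andbT -val_eqE /= !inordK. Qed.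

(* Averaging over the phases kills the coherences with |01> and |10>. *)
Lemma sum_phase_state s : s * s = 1 -> s^* = s ->
  phase_state s 1 + phase_state s (-1) + phase_state s 'i + phase_state s (- 'i)
  = 2 *: proj (bell s) + proj (ket R 0 1) + proj (ket R 1 0).
Proof.
move=> s2 sR.
have i2 : 'i * 'i = -1 :> C by rewrite -expr2 sqrCi.
have iR : 'i^* = - 'i :> C := conjCi _.
have c2 : (2^-1)^* = 2^-1 :> C by rewrite fmorphV rmorph_nat.
have h := invsqrt2_sqr; have hR := conj_invsqrt2.
rewrite !phase_stateE bell_vec4 ket01_vec4 ket10_vec4.
rewrite !rmorphN /= iR conjC1.
move: (invsqrt2 R) 'i i2 iR h hR => c z i2 iR h hR.
have h1 : c * (c * s) = 2^-1 * s by rewrite mulrA h.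
have h2 : c * s * c = 2^-1 * s by rewrite mulrAC h.
have h3 : c * s * (c * s) = 2^-1 by rewrite mulrACA h s2 mulr1.
apply/matrixP => k l; rewrite !mxE !big_ord1 !mxE.
case: k => [[|[|[|[|//]]]] ?]; case: l => [[|[|[|[|//]]]] ?] /=.
all: rewrite ?(rmorphM, rmorphN) /= ?(c2, sR, hR, iR, conjC1, conjC0, rmorphN) /=.
all: rewrite ?(h, h1, h2, h3).
all: by field: s2 i2.
Qed.

(** The coherences between |00> and |11> have opposite signs in the two projectors and cancel. *)
Lemma sum_proj_bell :
  proj (bell 1) + proj (bell (-1)) = proj (ket R 0 0) + proj (ket R 1 1).
Proof.
have -> : ket R 0 0 = vec4 1 0 0 0.
  by apply: vec4P; rewrite mxE eqxx andbT -val_eqE /= !inordK.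
have -> : ket R 1 1 = vec4 0 0 0 1.
  by apply: vec4P; rewrite mxE eqxx andbT -val_eqE /= !inordK.
have h := invsqrt2_sqr; have hR := conj_invsqrt2.
rewrite !bell_vec4 mulr1 mulrN1.
move: (invsqrt2 R) h hR => c h hR.
apply/matrixP => k l; rewrite !mxE !big_ord1 !mxE.
case: k => [[|[|[|[|//]]]] ?]; case: l => [[|[|[|[|//]]]] ?] /=.
all: rewrite ?rmorphN /= ?(hR, conjC1, conjC0) ?(mulrN, mulNr, opprK) ?h.
all: by field.
Qed.

(** The two Bell vectors form an orthonormal basis of the span of |00> and |11>, so the defect is
    the sum of the diagonal entries at |01> and |10>, both nonnegative. *)
Lemma trace_bell_exp A : psd A -> bell_exp 1 A + bell_exp (-1) A <= \tr A.
Proof.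
move=> pA; rewrite /mxtrace big_inord4 -subr_ge0.
have := addr_ge0 (psd_diag_ge0 (inord 1) pA) (psd_diag_ge0 (inord 2) pA).
by congr (0 <= _); rewrite /bell_exp; field.
Qed.

Lemma ReD (x y : C) : complex.Re (x + y) = complex.Re x + complex.Re y.
Proof. by case: x; case: y. Qed.

Lemma ReZ (a : R) (x : C) : complex.Re ((a%:C)%C * x) = a * complex.Re x.
Proof. by case: x => x y /=; rewrite mul0r subr0. Qed.

Lemma le_Re (x y : C) : x <= y -> complex.Re x <= complex.Re y.
Proof. by rewrite lecE => /andP[]. Qed.

(** * Constraints on the output probabilities of a non-entangling map *)

Section NonEntangling.
Variable L : {linear 'M[C]_4 -> 'M[C]_4}.
Hypothesis neL : non_entangling L.

(** This is Pr(s | A). Taking the real part gives a functional with values in [R], additive and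
    homogeneous over the reals, as the final linear program requires. *)
Definition out_prob s A : R := complex.Re (bell_exp s (L A)).

Lemma out_probD s A B : out_prob s (A + B) = out_prob s A + out_prob s B.
Proof. by rewrite /out_prob (linearD L) (linearD (bell_exp s)) ReD. Qed.

Lemma out_probZ s (a : R) A : out_prob s ((a%:C)%C *: A) = a * out_prob s A.
Proof. by rewrite /out_prob (linearZ_LR L) (linearZ_LR (bell_exp s)) ReZ. Qed.

Lemma out_prob_comb s (l1 l2 l3 l4 : R) B1 B2 B3 B4 :
  out_prob s ((l1%:C)%C *: B1 + (l2%:C)%C *: B2 + (l3%:C)%C *: B3 + (l4%:C)%C *: B4) =
  l1 * out_prob s B1 + l2 * out_prob s B2 + l3 * out_prob s B3 + l4 * out_prob s B4.
Proof. by rewrite !out_probD !out_probZ. Qed.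

Lemma out_prob_rho s (l1 l2 l3 l4 : R) : out_prob s (rho_lam l1 l2 l3 l4) =
  l1 * out_prob s (proj (bell 1)) + l2 * out_prob s (proj (ket R 0 1))
  + l3 * out_prob s (proj (bell (-1))) + l4 * out_prob s (proj (ket R 1 0)).
Proof. by rewrite /rho_lam /Phi1 /Phi2 Bell1E Bell2E; exact: out_prob_comb. Qed.

Lemma out_prob_ge0 s A : s * s = 1 -> s^* = s -> psd A -> 0 <= out_prob s A.
Proof.
move=> s2 sR pA; apply: (@le_Re 0 (bell_exp s (L A))).
by apply: bell_exp_ge0 => //; apply: completely_positive_psd pA; case: neL.
Qed.

Lemma out_prob_product s P : s * s = 1 -> s^* = s ->
  product_state P -> out_prob s P <= 2^-1.
Proof.
move=> s2 sR PP; case: neL => _ [_ sepL].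
have -> : 2^-1 = complex.Re 2^-1 :> R.
  by rewrite -(rmorph_nat (real_complex R)) -fmorphV.
apply: le_Re; apply: bell_exp_separable => //; apply: sepL.
  exact: product_state_state.
exact: product_state_separable.
Qed.

(** Each of the four product states with phases 1, -1, i, -i contributes at most 1/2, and
    [sum_phase_state] evaluates their sum. The measured sign [s] and the input sign [t] are
    independent. *)
Lemma out_prob_phase s t : s * s = 1 -> s^* = s -> t * t = 1 -> t^* = t ->
  2 * out_prob s (proj (bell t)) + out_prob s (proj (ket R 0 1))
    + out_prob s (proj (ket R 1 0)) <= 2.
Proof.
move=> s2 sR t2 tR.
have bound w : w * w^* = 1 -> out_prob s (phase_state t w) <= 2^-1.
  by move=> w1; apply: out_prob_product => //; apply: phase_state_product.
have i1 : 'i * ('i)^* = 1 :> C by rewrite conjCi mulrN -expr2 sqrCi opprK.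
have b1 : out_prob s (phase_state t 1) <= 2^-1 by apply: bound; rewrite conjC1 mulr1.
have b2 : out_prob s (phase_state t (-1)) <= 2^-1.
  by apply: bound; rewrite rmorphN /= conjC1 mulrNN mulr1.
have b3 := bound _ i1.
have b4 : out_prob s (phase_state t (- 'i)) <= 2^-1.
  by apply: bound; rewrite rmorphN /= mulrNN.
have := sum_phase_state t2 tR.
move: (phase_state t 1) (phase_state t (-1)) (phase_state t 'i)
  (phase_state t (- 'i)) (proj (bell t)) (proj (ket R 0 1)) (proj (ket R 1 0))
  b1 b2 b3 b4 => P1 P2 P3 P4 B K1 K2 b1 b2 b3 b4 /(congr1 (out_prob s)).
rewrite scaler_nat mulr2n !out_probD.
move: (out_prob s P1) (out_prob s P2) (out_prob s P3) (out_prob s P4)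
  (out_prob s B) (out_prob s K1) (out_prob s K2) b1 b2 b3 b4.
by move=> *; lra.
Qed.

(** The two projectors add up to those on |00> and |11>, which are product states and contribute at
    most 1/2 each. *)
Lemma out_prob_bell_sum s : s * s = 1 -> s^* = s ->
  out_prob s (proj (bell 1)) + out_prob s (proj (bell (-1))) <= 1.
Proof.
move=> s2 sR; rewrite -out_probD sum_proj_bell out_probD.
have b0 := out_prob_product s2 sR (product_state_ket (isT : 0 < 2)%N (isT : 0 < 2)%N).
have b1 := out_prob_product s2 sR (product_state_ket (isT : 1 < 2)%N (isT : 1 < 2)%N).
move: (out_prob s (proj (ket R 0 0))) (out_prob s (proj (ket R 1 1))) b0 b1.
by move=> *; lra.
Qed.

Lemma out_prob_trace A : psd A -> \tr A = 1 -> out_prob 1 A + out_prob (-1) A <= 1.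
Proof.
move=> pA tA; case: neL => cpL [tpL _].
have := le_Re (trace_bell_exp (completely_positive_psd cpL pA)).
by rewrite ReD tpL tA.
Qed.

End NonEntangling.

(** * Bell expectations of the target state *)

Lemma bell_exp_vec4 s a b c d :
  bell_exp s (proj (vec4 a b c d)) = (a * a^* + d * d^* + s * (a * d^* + d * a^*)) / 2.
Proof. by rewrite /bell_exp !projE !mxE !inordK. Qed.

Lemma bell_exp_bell s t : t * t = 1 -> t^* = t ->
  bell_exp s (proj (bell t)) = (1 + s * t) / 2.
Proof.
move=> t2 tR; rewrite bell_vec4 bell_exp_vec4 rmorphM /= tR conj_invsqrt2.
have h := invsqrt2_sqr; move: (invsqrt2 R) h => c h.
have -> : c * (c * t) = 2^-1 * t by rewrite mulrA h.
have -> : c * t * c = 2^-1 * t by rewrite mulrAC h.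
by rewrite mulrACA t2 h; field.
Qed.

(** The vectors of [Phi3] and [Phi4] vanish on |00> and |11>, so only the first two weights survive;
    [s = 1] selects [l1] and [s = -1] selects [l2]. *)
Lemma bell_exp_sigma s (l1 l2 l3 l4 : R) : bell_exp s (sigma_lam l1 l2 l3 l4) =
  (l1%:C)%C * ((1 + s) / 2) + (l2%:C)%C * ((1 - s) / 2).
Proof.
have e3 : Bell3 R = vec4 0 (invsqrt2 R) (invsqrt2 R) 0.
  by apply: vec4P; rewrite /Bell3 /ket !mxE !eqxx !andbT -!val_eqE /= !inordK //=;
    rewrite ?(mulr1, mulr0, addr0, add0r).
have e4 : Bell4 R = vec4 0 (- invsqrt2 R) (invsqrt2 R) 0.
  by apply: vec4P; rewrite /Bell4 /ket !mxE !eqxx !andbT -!val_eqE /= !inordK //=;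
    rewrite ?(mulr1, mulrN1, mulr0, addr0, add0r, oppr0).
rewrite /sigma_lam /Phi1 /Phi2 /Phi3 /Phi4 Bell1E Bell2E e3 e4.
have lin (B1 B2 B3 B4 : 'M[C]_4) x1 x2 x3 x4 :
    bell_exp s B1 = x1 -> bell_exp s B2 = x2 ->
    bell_exp s B3 = x3 -> bell_exp s B4 = x4 ->
    bell_exp s ((l1%:C)%C *: B1 + (l2%:C)%C *: B2
      + (l3%:C)%C *: B3 + (l4%:C)%C *: B4) =
    (l1%:C)%C * x1 + (l2%:C)%C * x2 + (l3%:C)%C * x3 + (l4%:C)%C * x4.
  by move=> <- <- <- <-; rewrite !(linearD (bell_exp s)) !(linearZ_LR (bell_exp s)).
have q1 := bell_exp_bell s (mulr1 1) (conjC1 C).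
have q2 := bell_exp_bell s (etrans (mulrNN 1 1) (mulr1 1)) (rmorphN1 (Num.conj : {rmorphism C -> C})).
have q3 c : bell_exp s (proj (vec4 0 c c 0)) = 0.
  by rewrite bell_exp_vec4 conjC0 !(mul0r, addr0, mulr0).
have q4 c : bell_exp s (proj (vec4 0 (- c) c 0)) = 0.
  by rewrite bell_exp_vec4 conjC0 !(mul0r, addr0, mulr0).
rewrite (lin _ _ _ _ _ _ _ _ q1 q2 (q3 _) (q4 _)).
by rewrite mulr1 mulrN1 !mulr0 !addr0.
Qed.

Lemma mxtrace_bell s : s * s = 1 -> s^* = s -> \tr (proj (bell s)) = 1.
Proof.
move=> s2 sR; rewrite /mxtrace big_inord4 bell_vec4 !projE !mxE !inordK //=.
by rewrite rmorphM /= sR conj_invsqrt2 mulrACA s2 invsqrt2_sqr; field.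
Qed.

End Expectations.

(** * Infeasibility of the linear program *)

(** The letters a, b, c, d stand for the inputs [Phi1], [Phi2], |01>, |10>; index 1 is the outcome
    [s = 1] and index 2 is [s = -1]. *)
Lemma regions_infeasible (R : realType) (l1 l2 l3 l4 a1 b1 c1 d1 a2 b2 c2 d2 : R) :
  l1 >= l2 -> l2 >= l3 -> l3 >= l4 -> l4 >= 0 ->
  regionA l1 l2 l3 l4 \/ regionB l1 l2 l3 l4 \/ regionC l1 l2 l3 l4 ->
  l1 * a1 + l2 * c1 + l3 * b1 + l4 * d1 = l1 ->
  l1 * a2 + l2 * c2 + l3 * b2 + l4 * d2 = l2 ->
  a1 + a2 <= 1 -> 0 <= a2 -> 0 <= b1 -> 0 <= c1 -> 0 <= d1 ->
  2 * a1 + c1 + d1 <= 2 -> a1 + b1 <= 1 ->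
  2 * b2 + c2 + d2 <= 2 -> c2 <= 2^-1 -> d2 <= 2^-1 -> 0 <= c2 -> 0 <= d2 -> False.
Proof.
move=> l12 l23 l34 l40 region rho1 rho2 a12 a2_ge0 b1_ge0 c1_ge0 d1_ge0 acd1 ab1
  bcd2 c2_le d2_le c2_ge0 d2_ge0.
have gap : 2 * l2 + l3 - l1 < 0 by case: region => [[]|[[]|[]]].
have l3_ge0 : 0 <= l3 by lra.
have l2_ge0 : 0 <= l2 by lra.
have a1E : a1 = 1.
  (* By [rho1], [l1 * (1 - a1)] equals [l2 * c1 + l3 * b1 + l4 * d1]. Raising [l4] to [l2] and using
     [acd1] and [ab1] bounds this by [(2 * l2 + l3) * (1 - a1)]; since [l1] exceeds [2 * l2 + l3],
     [1 - a1] cannot be positive. *)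
  have t1 : 0 <= (l2 - l4) * d1 by apply: mulr_ge0 => //; lra.
  have t2 : 0 <= l2 * (2 * (1 - a1) - c1 - d1) by apply: mulr_ge0 => //; lra.
  have t3 : 0 <= l3 * (1 - a1 - b1) by apply: mulr_ge0 => //; lra.
  have e0 : 0 <= 1 - a1 by lra.
  have t4 : (l1 - 2 * l2 - l3) * (1 - a1) <= 0 by lra.
  by move: t4; rewrite pmulr_rle0; lra.
have a2E : a2 = 0 by lra.
rewrite a2E in rho2.
case: region => [[_ hA]|[[_ [_ [h3 h2]]]|[_ [_ [h3 h2]]]]].
(* Region A: bounding [c2] and [d2] by 1/2 and [b2] by 1 gives [l2 <= 2 * l3 + l4]. *)
- have t1 : 0 <= l2 * (2^-1 - c2) by apply: mulr_ge0 => //; lra.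
  have t2 : 0 <= l3 * (1 - b2) by apply: mulr_ge0 => //; lra.
  have t3 : 0 <= l4 * (2^-1 - d2) by apply: mulr_ge0 => //; lra.
  lra.
(* Region B: the multipliers are dual to the vertex [c2 = d2 = b2 = 1/2]. The sum of [t1], half of
   [t2] and [t3] gives [l2 <= l3 + l4]. *)
- have t1 : 0 <= (l2 - l3 / 2) * (2^-1 - c2) by apply: mulr_ge0; lra.
  have t2 : 0 <= l3 * (2 - 2 * b2 - c2 - d2) by apply: mulr_ge0 => //; lra.
  have t3 : 0 <= (l4 - l3 / 2) * (2^-1 - d2) by apply: mulr_ge0; lra.
  lra.
(* Region C: as [l4 < l3 / 2], the optimal vertex moves to [c2 = 1/2], [d2 = 0], [b2 = 3/4], and the
   same combination gives [l2 <= 3 / 2 * l3]. *)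
- have t1 : 0 <= (l2 - l3 / 2) * (2^-1 - c2) by apply: mulr_ge0; lra.
  have t2 : 0 <= l3 * (2 - 2 * b2 - c2 - d2) by apply: mulr_ge0 => //; lra.
  have t3 : 0 <= (l3 / 2 - l4) * d2 by apply: mulr_ge0; lra.
  lra.
Qed.

Theorem theorem6 (R : realType) (l1 l2 l3 l4 : R) :
  l1 >= l2 -> l2 >= l3 -> l3 >= l4 -> l4 >= 0 -> l1 + l2 + l3 + l4 = 1 ->
  regionA l1 l2 l3 l4 \/ regionB l1 l2 l3 l4 \/ regionC l1 l2 l3 l4 ->
  ~ exists L : {linear 'M[R[i]]_4 -> 'M[R[i]]_4},
      non_entangling L /\ L (rho_lam l1 l2 l3 l4) = sigma_lam l1 l2 l3 l4.
Proof.
move=> l12 l23 l34 l40 _ region [L [neL Lrho]].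
have p2 : 1 * 1 = 1 :> R[i] by rewrite mulr1.
have n2 : -1 * -1 = 1 :> R[i] by rewrite mulrNN mulr1.
have pR : 1^* = 1 :> R[i] by rewrite conjC1.
have nR : (-1)^* = -1 :> R[i] by rewrite rmorphN /= conjC1.
have half2 : (1 + 1) / 2 = 1 :> R[i] by field.
have rho1 : out_prob L 1 (rho_lam l1 l2 l3 l4) = l1.
  by rewrite /out_prob Lrho bell_exp_sigma subrr mul0r mulr0 addr0 half2 mulr1.
have rho2 : out_prob L (-1) (rho_lam l1 l2 l3 l4) = l2.
  by rewrite /out_prob Lrho bell_exp_sigma subrr mul0r mulr0 add0r opprK half2 mulr1.
rewrite out_prob_rho in rho1; rewrite out_prob_rho in rho2.
have a12 := out_prob_trace neL (psd_proj (bell 1)) (mxtrace_bell p2 pR).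
have ge0 s v (s2 : s * s = 1) (sR : s^* = s) : 0 <= out_prob L s (proj v).
  by apply: out_prob_ge0 => //; exact: psd_proj.
have a2_ge0 := ge0 (-1) (bell 1) n2 nR.
have b1_ge0 := ge0 1 (bell (-1)) p2 pR.
have c1_ge0 := ge0 1 (ket R 0 1) p2 pR.
have d1_ge0 := ge0 1 (ket R 1 0) p2 pR.
(* Input and measured signs agree here and in [bcd2]: the probabilities on |01> and |10> are traded
   against that of [Phi1] for [s = 1] and of [Phi2] for [s = -1]. *)
have acd1 := out_prob_phase neL p2 pR p2 pR.
have ab1 := out_prob_bell_sum neL p2 pR.
have bcd2 := out_prob_phase neL n2 nR n2 nR.
have c2 := out_prob_product neL n2 nR
  (product_state_ket R (isT : 0 < 2)%N (isT : 1 < 2)%N).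
have d2 := out_prob_product neL n2 nR
  (product_state_ket R (isT : 1 < 2)%N (isT : 0 < 2)%N).
have c2_ge0 := ge0 (-1) (ket R 0 1) n2 nR.
have d2_ge0 := ge0 (-1) (ket R 1 0) n2 nR.
exact: regions_infeasible l12 l23 l34 l40 region rho1 rho2 a12 a2_ge0 b1_ge0 c1_ge0
  d1_ge0 acd1 ab1 bcd2 c2 d2 c2_ge0 d2_ge0.
Qed.
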